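(* Let $\mathcal P\subseteq\mathbb P^3\times\mathbb P^3$ be the subscheme where the six quadratic relations for $\widetilde Q$ vanish. Then $$\mathcal P=\{(\mathbf u,\mathbf v)\in\mathbb P^3\times\mathbb P^3 : \mathsf M_1(\mathbf u)\mathbf v^{\mathsf T}=0\}=\{(\mathbf u,\theta(\mathbf u)) : \mathbf u\in\mathfrak P\}$$ (as sets of points). In particular, $\mathcal P$ is the graph of the automorphism $\theta$ of $\mathfrak P$.
   Context: Let $k$ be an algebraically closed field of characteristic not $2$, and let $\alpha,\beta,\gamma\in k$ satisfy $\alpha+\beta+\gamma+\alpha\beta\gamma=0$ and $\{\alpha,\beta,\gamma\}\cap\{0,1,-1\}=\varnothing$; write $\alpha_1=\alpha,\alpha_2=\beta,\alpha_3=\gamma$. Fix $a,b,c,i\in k$ with $a^2=\alpha$, $b^2=\beta$, $c^2=\gamma$, $i^2=-1$. Let $\widetilde Q$ be the graded $k$-algebra generated by degree-one elements $y_0,y_1,y_2,y_3$ subject to the six relations $y_0y_i-y_iy_0=\alpha_i(y_jy_k-y_ky_j)$, $y_0y_i+y_iy_0=y_jy_k+y_ky_j$, $(i,j,k)$ running over the cyclic permutations of $(1,2,3)$. Let $V$ be the span of $y_0,\dots,y_3$ and $\mathbb P^3=\mathbb P(V^* )$ with coordinates $(y_0,y_1,y_2,y_3)$; the relations lie in $V^{\otimes 2}$ and are regarded as forms of bidegree $(1,1)$ on $\mathbb P^3\times\mathbb P^3$. They are the entries of $\mathsf M_1\cdot(y_0,y_1,y_2,y_3)^{\mathsf T}$,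 where $$\mathsf M_1=\begin{pmatrix} -y_1 & y_0 & \alpha y_3 & -\alpha y_2 \\ -y_2 & -\beta y_3 & y_0 & \beta y_1 \\ -y_3 & \gamma y_2 & -\gamma y_1 & y_0 \\ {} y_1 & y_0 & -y_3 & -y_2 \\ {} y_2 & -y_3 & y_0 & -y_1 \\ {} y_3 & -y_2 & -y_1 & y_0 \end{pmatrix}.$$ $\mathfrak P=\mathfrak P_\infty\cup\mathfrak P_0\cup\mathfrak P_1\cup\mathfrak P_2\cup\mathfrak P_3\subset\mathbb P^3$ is the following set of 20 points: $\mathfrak P_\infty=\{(1,0,0,0),(0,1,0,0),(0,0,1,0),(0,0,0,1)\}$; $\mathfrak P_0=\{(1,1,1,1),(1,1,-1,-1),(1,-1,1,-1),(1,-1,-1,1)\}$; $\mathfrak P_1=\{(bc,-i,-ib,-c),(bc,-i,ib,c),(bc,i,-ib,c),(bc,i,ib,-c)\}$; $\mathfrak P_2=\{(ac,-a,-i,-ic),(ac,-a,i,ic),(ac,a,-i,ic),(ac,a,i,-ic)\}$; $\mathfrak P_3=\{(ab,-ia,-b,-i),(ab,-ia,b,i),(ab,ia,-b,i),(ab,ia,b,-i)\}$. Let $\gamma_i$ ($i=1,2,3$) act on $\mathbb P^3$ by fixing coordinates $0$ and $i$ and negating the other two. $\theta:\mathfrak P\to\mathfrak P$ is defined by $\theta(\mathbf u)=\mathbf u$ for $\mathbf u\in\mathfrak P_\infty\cup\mathfrak P_0$ and $\theta(\mathbf u)=\gamma_i(\mathbf u)$ for $\mathbf u\in\mathfrak P_i$,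 $i=1,2,3$. *)

(* Defs.v *)
From HB Require Import structures.
From mathcomp Require Import all_boot all_order all_algebra.
From mathcomp Require Import boolp classical_sets functions.
From mathcomp Require Import monalg.

Set Implicit Arguments.
Unset Strict Implicit.
Unset Printing Implicit Defensive.

Import GRing.Theory.
Local Open Scope ring_scope.
Local Open Scope classical_set_scope.

(* A k-point of P^3 = P(V^* ) is a line in V^* = k^4, the row vector of a
   functional being its list of values at y_0, ..., y_3. *)
Record P3 (k : fieldType) :=
  MkP3 { line :> {vspace 'rV[k]_4}; _ : \dim line == 1%N }.

HB.instance Definition _ (k : fieldType) := [isSub for @line k].
HB.instance Definition _ (k : fieldType) := [Equality of P3 k by <:].

Section Relations.
Variable k : fieldType.

Definition free4 := {malg k[{fmonom 'I_4}]}.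

Definition y (p : 'I_4) : free4 := << fmu p >>.

Definition rel_minus (t : k) (i j l : 'I_4) : free4 :=
  y 0 * y i - y i * y 0 - t *: (y j * y l - y l * y j).

Definition rel_plus (i j l : 'I_4) : free4 :=
  y 0 * y i + y i * y 0 - (y j * y l + y l * y j).

Definition Qtilde_relations (alpha beta gamma : k) : seq free4 :=
  [:: rel_minus alpha 1 2 3; rel_minus beta 2 3 1; rel_minus gamma 3 1 2;
      rel_plus 1 2 3; rel_plus 2 3 1; rel_plus 3 1 2].

(* A noncommutative quadratic form is an element of V (x) V, hence a form of
   bidegree (1,1): y_p y_q takes the value u_p v_q at (u, v). *)
Definition biform (f : free4) (u v : 'rV[k]_4) : k :=
  \sum_(p < 4) \sum_(q < 4) f@_(fmmul (fmu p) (fmu q)) * u 0 p * v 0 q.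

Definition point_scheme (alpha beta gamma : k) : set (P3 k * P3 k) :=
  [set pq | forall f, f \in Qtilde_relations alpha beta gamma ->
     forall u v, u \in line pq.1 -> v \in line pq.2 -> biform f u v = 0].

Definition M1 (alpha beta gamma : k) (u : 'rV[k]_4) : 'M[k]_(6, 4) :=
  let y0 := u 0 0 in let y1 := u 0 1 in let y2 := u 0 2 in let y3 := u 0 3 in
  \matrix_(r < 6, s < 4)
    (nth [::] [:: [:: - y1; y0; alpha * y3; - (alpha * y2)];
                  [:: - y2; - (beta * y3); y0; beta * y1];
                  [:: - y3; gamma * y2; - (gamma * y1); y0];
                  [:: y1; y0; - y3; - y2];
                  [:: y2; - y3; y0; - y1];
                  [:: y3; - y2; - y1; y0]] r)`_s.

Definition M1_locus (alpha beta gamma : k) : set (P3 k * P3 k) :=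
  [set pq | forall u v, u \in line pq.1 -> v \in line pq.2 ->
     M1 alpha beta gamma u *m v^T = 0].

End Relations.

Section Points.
Variable k : fieldType.

Definition vec4 (x0 x1 x2 x3 : k) : 'rV[k]_4 :=
  \row_(j < 4) [:: x0; x1; x2; x3]`_j.

Definition has_coords (s : seq 'rV[k]_4) (p : P3 k) : bool :=
  line p \in [seq <[u]>%VS | u <- s].

Definition PPinf : pred (P3 k) := has_coords
  [:: vec4 1 0 0 0; vec4 0 1 0 0; vec4 0 0 1 0; vec4 0 0 0 1].

Definition PP0 : pred (P3 k) := has_coords
  [:: vec4 1 1 1 1; vec4 1 1 (- 1) (- 1);
      vec4 1 (- 1) 1 (- 1); vec4 1 (- 1) (- 1) 1].

Definition PP1 (b c i : k) : pred (P3 k) := has_coords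
  [:: vec4 (b * c) (- i) (- (i * b)) (- c);
      vec4 (b * c) (- i) (i * b) c;
      vec4 (b * c) i (- (i * b)) c;
      vec4 (b * c) i (i * b) (- c)].

Definition PP2 (a c i : k) : pred (P3 k) := has_coords
  [:: vec4 (a * c) (- a) (- i) (- (i * c));
      vec4 (a * c) (- a) i (i * c);
      vec4 (a * c) a (- i) (i * c);
      vec4 (a * c) a i (- (i * c))].

Definition PP3 (a b i : k) : pred (P3 k) := has_coords
  [:: vec4 (a * b) (- (i * a)) (- b) (- i);
      vec4 (a * b) (- (i * a)) b i;
      vec4 (a * b) (i * a) (- b) i;
      vec4 (a * b) (i * a) b (- i)].

Definition PP (a b c i : k) : set (P3 k) :=
  [set p | [|| PPinf p, PP0 p, PP1 b c i p, PP2 a c i p | PP3 a b i p]].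

Definition flip_mx (j : 'I_4) : 'M[k]_4 :=
  diag_mx (\row_l (if (l == 0) || (l == j) then 1 else - 1)).

Definition flip_lin (j : 'I_4) : 'End('rV[k]_4) :=
  linfun (mulmxr (flip_mx j)).

Lemma flip_mxK (j : 'I_4) : flip_mx j *m flip_mx j = 1%:M.
Proof.
rewrite mulmx_diag; apply/matrixP=> p q; rewrite !mxE.
by case: ifP => _; rewrite ?mulr1 ?mulrNN ?mulr1.
Qed.

Lemma flip_dim (j : 'I_4) (p : P3 k) : \dim (flip_lin j @: line p)%VS == 1%N.
Proof.
case: p => L /= /eqP dL; apply/eqP; rewrite -[RHS]dL; apply: limg_dim_eq.
suff -> : lker (flip_lin j) = 0%VS by rewrite capv0.
apply/eqP/lker0P => u v; rewrite !lfunE /= => uv.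
by rewrite -[u]mulmx1 -[v]mulmx1 -(flip_mxK j) !mulmxA uv.
Qed.

(* The action of gamma_j on P^3. *)
Definition flip (j : 'I_4) (p : P3 k) : P3 k := MkP3 (flip_dim j p).

(* The map theta, extended by the identity outside PP. The case analysis is
   unambiguous under the standing assumptions, see thetaE below. *)
Definition theta (a b c i : k) (p : P3 k) : P3 k :=
  if PP1 b c i p then flip 1 p
  else if PP2 a c i p then flip 2 p
  else if PP3 a b i p then flip 3 p
  else p.

Lemma line_cross (u v : 'rV[k]_4) (p q : 'I_4) :
  <[u]>%VS = <[v]>%VS -> u 0 p * v 0 q = u 0 q * v 0 p.
Proof.
move=> uv; have : u \in <[v]>%VS by rewrite -uv memv_line.
by case/vlineP => t ->; rewrite !mxE mulrAC.
Qed.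

(* The squares of homogeneous coordinates are constant on each PP_j. *)
Definition squares (s : seq 'rV[k]_4) (d : seq k) : bool :=
  all (fun u : 'rV[k]_4 => [forall q, u 0 q ^+ 2 == d`_q]) s.

Lemma squares_disjoint (s t : seq 'rV[k]_4) (d e : seq k) (m n : 'I_4)
    (p : P3 k) :
  squares s d -> squares t e -> d`_m * e`_n != d`_n * e`_m ->
  has_coords s p -> has_coords t p -> False.
Proof.
move=> /allP sd /allP te de /mapP[u /sd/forallP us pu] /mapP[v /te/forallP vt pv].
move/eqP: de; apply.
rewrite -!(eqP (us _)) -!(eqP (vt _)) -!exprMn.
by rewrite (line_cross m n (etrans (esym pu) pv)).
Qed.

Section ThetaE.
Variables alpha beta gamma a b c i : k.
Hypotheses (alpha_ok : alpha \notin [:: 0; 1; - 1])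
  (beta_ok : beta \notin [:: 0; 1; - 1])
  (gamma_ok : gamma \notin [:: 0; 1; - 1])
  (a2 : a ^+ 2 = alpha) (b2 : b ^+ 2 = beta) (c2 : c ^+ 2 = gamma)
  (i2 : i ^+ 2 = - 1).

Let sq0 : squares [:: vec4 1 1 1 1; vec4 1 1 (- 1) (- 1);
  vec4 1 (- 1) 1 (- 1); vec4 1 (- 1) (- 1) 1] [:: 1; 1; 1; 1].
Proof.
by rewrite /squares /= !andbT; apply/and4P; split;
  apply/forallP => -[[|[|[|[|]]]]] //= ?; rewrite !mxE /= ?sqrrN ?expr1n.
Qed.

Let sq1 : squares [:: vec4 (b * c) (- i) (- (i * b)) (- c);
  vec4 (b * c) (- i) (i * b) c; vec4 (b * c) i (- (i * b)) c;
  vec4 (b * c) i (i * b) (- c)] [:: beta * gamma; - 1; - beta; gamma].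
Proof.
by rewrite /squares /= !andbT; apply/and4P; split;
  apply/forallP => -[[|[|[|[|]]]]] //= ?;
  rewrite !mxE /= ?sqrrN ?exprMn ?b2 ?c2 ?i2 ?mulN1r.
Qed.

Let sq2 : squares [:: vec4 (a * c) (- a) (- i) (- (i * c));
  vec4 (a * c) (- a) i (i * c); vec4 (a * c) a (- i) (i * c);
  vec4 (a * c) a i (- (i * c))] [:: alpha * gamma; alpha; - 1; - gamma].
Proof.
by rewrite /squares /= !andbT; apply/and4P; split;
  apply/forallP => -[[|[|[|[|]]]]] //= ?;
  rewrite !mxE /= ?sqrrN ?exprMn ?a2 ?c2 ?i2 ?mulN1r.
Qed.

Let sq3 : squares [:: vec4 (a * b) (- (i * a)) (- b) (- i);
  vec4 (a * b) (- (i * a)) b i; vec4 (a * b) (i * a) (- b) i;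
  vec4 (a * b) (i * a) b (- i)] [:: alpha * beta; - alpha; beta; - 1].
Proof.
by rewrite /squares /= !andbT; apply/and4P; split;
  apply/forallP => -[[|[|[|[|]]]]] //= ?;
  rewrite !mxE /= ?sqrrN ?exprMn ?a2 ?b2 ?i2 ?mulN1r.
Qed.

Lemma PPinf_disjoint s d p : squares s d ->
  all [pred x | x != 0] [:: d`_0; d`_1; d`_2; d`_3] ->
  PPinf p -> has_coords s p -> False.
Proof.
move=> /allP sd /and5P[d0 d1 d2 d3 _] /mapP[e eE pe] /mapP[v /sd/forallP vd pv].
have vn q : v 0 q != 0.
  have : v 0 q ^+ 2 != 0.
    by rewrite (eqP (vd q)); case: q => -[|[|[|[|]]]].
  by apply: contraNneq => ->; rewrite expr0n.
have cr m n : e 0 m = 1 -> e 0 n = 0 -> False.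
  move=> em en; have := line_cross m n (etrans (esym pe) pv).
  by rewrite em en mul1r mul0r => /eqP; apply/negP.
move: eE; rewrite !inE => /or4P[] /eqP eE; rewrite eE in cr.
- by apply: (cr 0 1); rewrite mxE.
- by apply: (cr 1 0); rewrite mxE.
- by apply: (cr 2 0); rewrite mxE.
- by apply: (cr 3 0); rewrite mxE.
Qed.

Lemma thetaE p :
  [/\ PPinf p || PP0 p -> theta a b c i p = p,
      PP1 b c i p -> theta a b c i p = flip 1 p,
      PP2 a c i p -> theta a b c i p = flip 2 p
    & PP3 a b i p -> theta a b c i p = flip 3 p].
Proof.
move: alpha_ok beta_ok gamma_ok; rewrite !inE !negb_or.
move=> /and3P[al0 al1 al2] /and3P[be0 be1 be2] /and3P[ga0 ga1 ga2].
have N1 : (- 1 : k) != 0 by rewrite oppr_eq0 oner_eq0.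
have d01 : PP0 p -> PP1 b c i p -> False.
  apply: (squares_disjoint (m := 0) (n := 2) sq0 sq1) => /=.
  by rewrite !mul1r -mulrN1 (inj_eq (mulfI be0)) eq_sym.
have d02 : PP0 p -> PP2 a c i p -> False.
  apply: (squares_disjoint (m := 1) (n := 0) sq0 sq2) => /=.
  by rewrite !mul1r -[X in _ == X]mulr1 (inj_eq (mulfI al0)).
have d03 : PP0 p -> PP3 a b i p -> False.
  apply: (squares_disjoint (m := 1) (n := 0) sq0 sq3) => /=.
  by rewrite !mul1r -mulrN1 (inj_eq (mulfI al0)).
have d12 : PP1 b c i p -> PP2 a c i p -> False.
  apply: (squares_disjoint (m := 0) (n := 1) sq1 sq2) => /=.
  rewrite mulN1r -mulrA [gamma * alpha]mulrC -mulN1r.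
  by rewrite (inj_eq (mulIf (mulf_neq0 al0 ga0))).
have d13 : PP1 b c i p -> PP3 a b i p -> False.
  apply: (squares_disjoint (m := 0) (n := 1) sq1 sq3) => /=.
  rewrite mulN1r mulrN eqr_opp mulrAC [alpha * beta]mulrC -[X in _ != X]mulr1.
  by rewrite (inj_eq (mulfI (mulf_neq0 be0 al0))).
have d23 : PP2 a c i p -> PP3 a b i p -> False.
  apply: (squares_disjoint (m := 0) (n := 2) sq2 sq3) => /=.
  rewrite mulrAC [X in X != _]mulrC mulN1r -[X in _ != X]mulN1r.
  by rewrite (inj_eq (mulIf (mulf_neq0 al0 be0))).
have i1 : PPinf p -> PP1 b c i p -> False.
  by apply: PPinf_disjoint sq1 _; rewrite /= !oppr_eq0 !mulf_eq0 !negb_or be0 ga0 oner_eq0.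
have i2' : PPinf p -> PP2 a c i p -> False.
  by apply: PPinf_disjoint sq2 _; rewrite /= !oppr_eq0 !mulf_eq0 !negb_or al0 ga0 oner_eq0.
have i3 : PPinf p -> PP3 a b i p -> False.
  by apply: PPinf_disjoint sq3 _; rewrite /= !oppr_eq0 !mulf_eq0 !negb_or al0 be0 oner_eq0.
rewrite /theta; case: (PPinf p) (PP0 p) (PP1 _ _ _ p) (PP2 _ _ _ p) (PP3 _ _ _ p)
  d01 d02 d03 d12 d13 d23 i1 i2' i3 => -[] [] [] [] d01 d02 d03 d12 d13 d23 i1 i2' i3;
  split=> // _; exfalso; auto.
Qed.
End ThetaE.

End Points.

(* Main.v *)
(* For a zero (u, v) put m_pq = u_p v_q.  The relations determine m_0i and m_i0
   linearly from m_jl and m_lj, and comparing products such as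
   m_0i m_jl = m_0l m_ji shows that the differences m_jl^2 - m_lj^2, for the
   three cyclic permutations (i, j, l), are proportional in a cycle.  The
   constraint on the parameters forces all three to vanish, so m_jl = m_lj or
   m_jl = - m_lj for each i.  If the sign is + three times, u lies in P_0; if
   it is + only at i, u lies in P_i; otherwise all off-diagonal m_pq vanish and
   u lies in P_infinity. *)
Require Import Defs.
From mathcomp Require Import all_boot all_order all_algebra ring.
From mathcomp Require Import boolp classical_sets functions.
From mathcomp Require Import monalg.

Set Implicit Arguments.
Unset Strict Implicit.
Unset Printing Implicit Defensive.

Import GRing.Theory.
Local Open Scope ring_scope.
Local Open Scope classical_set_scope.

(** * Algebra of the products u_p v_q for a cyclic triple (i, j, l) *)

Section CyclicRelations.
Variable k : fieldType.
Implicit Types (t al be ga b c : k) (i j l : 'I_4) (u v : 'rV[k]_4).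

Definition cyc_rel t i j l u v :=
  u 0 0 * v 0 i - u 0 i * v 0 0 = t * (u 0 j * v 0 l - u 0 l * v 0 j) /\
  u 0 0 * v 0 i + u 0 i * v 0 0 = u 0 j * v 0 l + u 0 l * v 0 j.

Definition cyc_rels al be ga i j l u v :=
  [/\ cyc_rel al i j l u v, cyc_rel be j l i u v & cyc_rel ga l i j u v].

Definition cross2 j l u v := (u 0 j * v 0 l) ^+ 2 - (u 0 l * v 0 j) ^+ 2.

(* The products u_p v_q attached to i, according to whether
   u_j v_l = u_l v_j or u_j v_l = - u_l v_j. *)
Definition cyc_sym i j l u v :=
  [/\ u 0 0 * v 0 i = u 0 j * v 0 l, u 0 i * v 0 0 = u 0 j * v 0 l
    & u 0 l * v 0 j = u 0 j * v 0 l].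

Definition cyc_skew t i j l u v :=
  [/\ u 0 0 * v 0 i = t * (u 0 j * v 0 l),
      u 0 i * v 0 0 = - (t * (u 0 j * v 0 l))
    & u 0 l * v 0 j = - (u 0 j * v 0 l)].

Definition decoupled i j l u v :=
  [/\ u 0 0 * v 0 i = 0, u 0 i * v 0 0 = 0, u 0 j * v 0 l = 0
    & u 0 l * v 0 j = 0].

Lemma cyc_rels_rot al be ga i j l u v :
  cyc_rels al be ga i j l u v -> cyc_rels be ga al j l i u v.
Proof. by case. Qed.

Lemma cyc_rel_double t i j l u v : cyc_rel t i j l u v ->
  2 * (u 0 0 * v 0 i)
    = (1 + t) * (u 0 j * v 0 l) + (1 - t) * (u 0 l * v 0 j) /\
  2 * (u 0 i * v 0 0)
    = (1 - t) * (u 0 j * v 0 l) + (1 + t) * (u 0 l * v 0 j).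
Proof.
case=> hm hp; split.
  transitivity (u 0 0 * v 0 i - u 0 i * v 0 0
    + (u 0 0 * v 0 i + u 0 i * v 0 0)); first by ring.
  by rewrite hm hp; ring.
transitivity (u 0 0 * v 0 i + u 0 i * v 0 0
  - (u 0 0 * v 0 i - u 0 i * v 0 0)); first by ring.
by rewrite hm hp; ring.
Qed.

(** The products u_0 v_i u_j v_l and u_i v_0 u_l v_j can each be regrouped by exchanging the
    v-indices: the first as (u_0 v_l)(u_j v_i), the second as (u_l v_0)(u_i v_j). Expressing the
    factors with index 0 through the relations at i on one side and at l on the other, the mixed
    terms cancel and only differences of squares remain. *)
Lemma cross2_step al be ga i j l u v : cyc_rels al be ga i j l u v ->
  (1 + al) * cross2 j l u v = - ((1 - ga) * cross2 i j u v).
Proof.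
move=> [/cyc_rel_double[hi hi'] _ /cyc_rel_double[hl hl']].
apply/eqP; rewrite -subr_eq0; apply/eqP.
transitivity (2 * (u 0 0 * v 0 i) * (u 0 j * v 0 l)
  - 2 * (u 0 i * v 0 0) * (u 0 l * v 0 j)
  - 2 * (u 0 0 * v 0 l) * (u 0 j * v 0 i)
  + 2 * (u 0 l * v 0 0) * (u 0 i * v 0 j)); last by ring.
by rewrite hi hi' hl hl' /cross2; ring.
Qed.

(* The three steps chain to a multiple of cross2 whose factor is the sum of
   the two products below; the constraint on the parameters makes these
   products equal. *)
Lemma cross2_eq0 al be ga i j l u v :
  (2 : k) != 0 -> al + be + ga + al * be * ga = 0 ->
  1 + al != 0 -> 1 + be != 0 -> 1 + ga != 0 ->
  cyc_rels al be ga i j l u v -> cross2 j l u v = 0.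
Proof.
move=> n2 abg nal nbe nga r.
have h1 := cross2_step r.
have h2 := cross2_step (cyc_rels_rot r).
have h3 := cross2_step (cyc_rels_rot (cyc_rels_rot r)).
have abg' : (1 - al) * (1 - be) * (1 - ga) = (1 + al) * (1 + be) * (1 + ga).
  apply/eqP; rewrite -subr_eq0; apply/eqP.
  by transitivity (- 2 * (al + be + ga + al * be * ga));
    [ring | rewrite abg mulr0].
have : 2 * ((1 + al) * (1 + be) * (1 + ga)) * cross2 j l u v = 0.
  transitivity ((1 + be) * (1 + ga) * ((1 + al) * cross2 j l u v)
    + (1 + al) * (1 + be) * (1 + ga) * cross2 j l u v); first by ring.
  rewrite h1.
  transitivity (- ((1 + be) * (1 - ga) * ((1 + ga) * cross2 i j u v))
    + (1 + al) * (1 + be) * (1 + ga) * cross2 j l u v); first by ring.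
  rewrite h3.
  transitivity ((1 - ga) * (1 - be) * ((1 + be) * cross2 l i u v)
    + (1 + al) * (1 + be) * (1 + ga) * cross2 j l u v); first by ring.
  by rewrite h2 -abg'; ring.
move/eqP; rewrite !mulf_eq0 (negbTE n2) (negbTE nal) (negbTE nbe) (negbTE nga).
by move/eqP.
Qed.

(** A vanishing [cross2] leaves only a sign. In the doubled relations the plus sign gives (1 + t) +
    (1 - t) = 2, so t disappears; the minus sign gives (1 + t) - (1 - t) = 2t, so t survives as a
    factor. *)
Lemma cyc_sym_or_skew t i j l u v : (2 : k) != 0 ->
  cyc_rel t i j l u v -> cross2 j l u v = 0 ->
  cyc_sym i j l u v \/ cyc_skew t i j l u v.
Proof.
move=> n2 /cyc_rel_double[hi hi'] /eqP; rewrite subr_eq0 eqf_sqr.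
case/orP=> /eqP h; [left | right]; split; try by rewrite h ?opprK.
- by apply: (mulfI n2); rewrite hi h; ring.
- by apply: (mulfI n2); rewrite hi' h; ring.
- by apply: (mulfI n2); rewrite hi h; ring.
- by apply: (mulfI n2); rewrite hi' h; ring.
Qed.

Lemma cyc_decoupled t i j l u v : cyc_sym i j l u v \/ cyc_skew t i j l u v ->
  u 0 j * v 0 l = 0 -> decoupled i j l u v.
Proof.
by rewrite /decoupled => -[] [-> -> ->] ->; rewrite ?mulr0 ?oppr0.
Qed.

(** Exchanging v-indices shows that al m1^2, be m2^2 and ga m3^2 are pairwise opposite. Three
    pairwise opposite elements are each their own opposite, hence zero away from characteristic
    2. *)
Lemma cyc_skew_skew_skew al be ga i j l u v : (2 : k) != 0 -> al != 0 ->
  cyc_skew al i j l u v -> cyc_skew be j l i u v -> cyc_skew ga l i j u v ->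
  u 0 j * v 0 l = 0.
Proof.
move=> n2 nal; have n2a := mulf_neq0 n2 nal; move=> [i1 i2 i3] [j1 j2 j3] [l1 l2 l3].
set m1 := u 0 j * v 0 l in i1 i2 i3 *.
set m2 := u 0 l * v 0 i in j1 j2 j3.
set m3 := u 0 i * v 0 j in l1 l2 l3.
have A : al * m1 * m1 = ga * m3 * - m3 by rewrite -i1 -l1 -l3 /m1; ring.
have B : be * m2 * - m2 = ga * m3 * m3 by rewrite -j1 -l1 -j3 /m3; ring.
have C : al * m1 * - m1 = be * m2 * m2 by rewrite -i1 -j1 -i3 /m2; ring.
have : 2 * al * (m1 * m1) = 0.
  transitivity (al * m1 * m1 - al * m1 * - m1); first by ring.
  rewrite A C.
  transitivity (- (ga * m3 * m3) + be * m2 * - m2); first by ring.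
  by rewrite B; ring.
by move/eqP; rewrite mulf_eq0 (negbTE n2a) mulf_eq0 orbb => /eqP.
Qed.

(** Here the exchanges give al m1^2 = m3^2 = m2^2 = - al m1^2, so m1 vanishes first and the other
    two follow. *)
Lemma cyc_skew_sym_sym al i j l u v : (2 : k) != 0 -> al != 0 ->
  cyc_skew al i j l u v -> cyc_sym j l i u v -> cyc_sym l i j u v ->
  [/\ u 0 j * v 0 l = 0, u 0 l * v 0 i = 0 & u 0 i * v 0 j = 0].
Proof.
move=> n2 nal; have n2a := mulf_neq0 n2 nal; move=> [i1 i2 i3] [j1 j2 j3] [l1 l2 l3].
set m1 := u 0 j * v 0 l in i1 i2 i3 *.
set m2 := u 0 l * v 0 i in j1 j2 j3 *.
set m3 := u 0 i * v 0 j in l1 l2 l3 *.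
have A : al * m1 * m1 = m3 * m3 by rewrite -i1 -{1}l1 -l3 /m1; ring.
have B : m2 * m2 = m3 * m3 by rewrite -{1}j1 -{1}l1 -j3 /m3; ring.
have C : al * m1 * - m1 = m2 * m2 by rewrite -i1 -{1}j1 -i3 /m2; ring.
have : 2 * al * (m1 * m1) = 0.
  by transitivity (al * m1 * m1 - al * m1 * - m1); [ring | rewrite A C B; ring].
move/eqP; rewrite mulf_eq0 (negbTE n2a) mulf_eq0 orbb => /eqP m10.
move: A B; rewrite m10 mulr0 => /esym/eqP; rewrite mulf_eq0 orbb => /eqP ->.
by rewrite mulr0 => /eqP; rewrite mulf_eq0 orbb => /eqP ->.
Qed.

Lemma cyc_sym_sym_sym_sqr i j l u v :
  cyc_sym i j l u v -> cyc_sym j l i u v -> cyc_sym l i j u v ->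
  (u 0 l * v 0 i) ^+ 2 = (u 0 j * v 0 l) ^+ 2 /\
  (u 0 i * v 0 j) ^+ 2 = (u 0 j * v 0 l) ^+ 2.
Proof.
move=> [i1 i2 i3] [j1 j2 j3] [l1 l2 l3]; split.
  by rewrite 2!expr2 -{1}j1 -{1}i1 -i3; ring.
by rewrite 2!expr2 -{1}l1 -l3 -{1}i1; ring.
Qed.

Lemma cyc_sym_sym_sym i j l u v :
  cyc_sym i j l u v -> cyc_sym j l i u v -> cyc_sym l i j u v ->
  u 0 j * v 0 l != 0 ->
  [/\ u 0 0 != 0, v 0 0 != 0,
      [/\ v 0 i = v 0 0 / u 0 0 * u 0 i, v 0 j = v 0 0 / u 0 0 * u 0 j
        & v 0 l = v 0 0 / u 0 0 * u 0 l]
    & exists e e' : bool, [/\ u 0 i = (-1) ^+ (e (+) e') * u 0 0,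
      u 0 j = (-1) ^+ e * u 0 0 & u 0 l = (-1) ^+ e' * u 0 0]].
Proof.
move=> ai aj al; have [B A] := cyc_sym_sym_sym_sqr ai aj al.
move: ai aj al => [i1 i2 i3] [j1 j2 j3] [l1 l2 l3] n.
have := n; rewrite -{1}i1 mulf_eq0 negb_or => /andP[u0 vi].
have := n; rewrite -{1}i2 mulf_eq0 negb_or => /andP[ui v0].
have := n; rewrite mulf_eq0 negb_or => /andP[uj vl].
split=> //.
  split; apply: (mulfI u0); rewrite mulrA mulrCA mulfV // mulr1 mulrC.
  - by rewrite mulrC i1 -i2 mulrC.
  - by rewrite mulrC j1 -j2 mulrC.
  - by rewrite mulrC l1 -l2 mulrC.
set m1 := u 0 j * v 0 l in n i1 i2 i3 A B *.
set m2 := u 0 l * v 0 i in j1 j2 j3 B *.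
set m3 := u 0 i * v 0 j in l1 l2 l3 A *.
have sgn (x z : k) : x ^+ 2 = z ^+ 2 -> exists e : bool, x = (-1) ^+ e * z.
  move/eqP; rewrite eqf_sqr => /orP[] /eqP ->; first by exists false; rewrite mul1r.
  by exists true; rewrite mulN1r.
have [e eE] := sgn _ _ A; have [e' e'E] := sgn _ _ B.
(* The signs are e for m3 / m1 and e' for m2 / m1. Multiplying by a nonzero coordinate of v turns
   u_i / u_0, u_j / u_0, u_l / u_0 into m3 / m2, m3 / m1, m2 / m1. *)
exists e, e'; split.
- have vj : v 0 j != 0.
    move: n; rewrite -i3 mulf_eq0 negb_or => /andP[_ //].
  apply: (mulIf vj); rewrite -/m3 -mulrA j1 e'E eE [RHS]mulrA -signr_addb.
  by rewrite -addbA addbb addbF.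
- by apply: (mulIf vi); rewrite l3 -mulrA i1.
- by apply: (mulIf vi); rewrite -/m2 -mulrA i1.
Qed.

Lemma cyc_sym_skew_skew_sqr be ga i j l u v :
  cyc_sym i j l u v -> cyc_skew be j l i u v -> cyc_skew ga l i j u v ->
  (u 0 j * v 0 l) ^+ 2 = - (ga * (u 0 i * v 0 j) ^+ 2) /\
  (u 0 j * v 0 l) ^+ 2 = be * (u 0 l * v 0 i) ^+ 2.
Proof.
move=> [i1 i2 i3] [j1 j2 j3] [l1 l2 l3]; split.
  transitivity (ga * (u 0 i * v 0 j) * - (u 0 i * v 0 j)); last by ring.
  by rewrite -l1 -l3 expr2 -{1}i1; ring.
transitivity (be * (u 0 l * v 0 i) * (u 0 l * v 0 i)); last by ring.
by rewrite -j1 expr2 -{1}i1 -i3; ring.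
Qed.

(** The skew relations at j and l give u_0 v_j = - u_j v_0 and u_0 v_l = - u_l v_0, so v is
    proportional to u with coordinates j and l negated. The squares satisfy h^2 = - ga f^2 = be g^2,
    and the chosen roots b, c, r make both right-hand sides squares; the two remaining signs are e
    and e'. *)
Lemma cyc_sym_skew_skew be ga b c r i j l u v :
  be != 0 -> ga != 0 -> b ^+ 2 = be -> c ^+ 2 = ga -> r ^+ 2 = -1 ->
  cyc_sym i j l u v -> cyc_skew be j l i u v -> cyc_skew ga l i j u v ->
  u 0 j * v 0 l != 0 ->
  [/\ u 0 0 != 0, v 0 0 != 0,
      [/\ v 0 i = v 0 0 / u 0 0 * u 0 i, v 0 j = v 0 0 / u 0 0 * - u 0 j
        & v 0 l = v 0 0 / u 0 0 * - u 0 l]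
    & exists e e' : bool,
      [/\ u 0 i = u 0 0 / (b * c) * - ((-1) ^+ (e (+) e') * r),
          u 0 j = u 0 0 / (b * c) * ((-1) ^+ e * (r * b))
        & u 0 l = u 0 0 / (b * c) * ((-1) ^+ e' * c)]].
Proof.
move=> nbe nga b2 c2 r2 ai sj sl; have [Q1 Q2] := cyc_sym_skew_skew_sqr ai sj sl.
move: ai sj sl => [i1 i2 i3] [j1 j2 j3] [l1 l2 l3] n.
have nb : b != 0 by apply: contraNneq nbe => b0; rewrite -b2 b0 expr0n.
have nc : c != 0 by apply: contraNneq nga => c0; rewrite -c2 c0 expr0n.
have nr : r != 0.
  apply/eqP => r0; move/eqP: r2.
  by rewrite r0 expr0n eq_sym oppr_eq0 oner_eq0.
have := n; rewrite -{1}i1 mulf_eq0 negb_or => /andP[u0 vi].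
have := n; rewrite -{1}i2 mulf_eq0 negb_or => /andP[ui v0].
have := n; rewrite -{1}i3 mulf_eq0 negb_or => /andP[ul vj].
split=> //.
  split; apply: (mulfI u0); rewrite mulrA mulrCA mulfV // mulr1.
  - by rewrite i1 -i2 mulrC.
  - by rewrite j1 mulrN [v 0 0 * _]mulrC j2 opprK.
  - by rewrite l1 mulrN [v 0 0 * _]mulrC l2 opprK.
set h := u 0 j * v 0 l in n i1 i2 i3 Q1 Q2 *.
set g := u 0 l * v 0 i in j1 j2 j3 Q2 *.
set f := u 0 i * v 0 j in l1 l2 l3 Q1 *.
have A : h ^+ 2 = (r * c * f) ^+ 2.
  transitivity (r ^+ 2 * c ^+ 2 * f ^+ 2); last by ring.
  by rewrite Q1 r2 c2; ring.
have B : h ^+ 2 = (b * g) ^+ 2.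
  by transitivity (b ^+ 2 * g ^+ 2); [rewrite Q2 b2 | ring].
have sgn (x z : k) : x ^+ 2 = z ^+ 2 -> exists e : bool, z = (-1) ^+ e * x.
  move/eqP; rewrite eqf_sqr => /orP[] /eqP ->; first by exists false; rewrite mul1r.
  by exists true; rewrite mulN1r opprK.
have [e eE] := sgn _ _ A; have [e' e'E] := sgn _ _ B.
have nbc : b * c != 0 by rewrite mulf_neq0.
(* The ratio x / u_0 is read off after multiplying by a nonzero coordinate w of v, which turns
   coordinates of u into the known products. *)
have solve (x z w : k) : w != 0 -> b * c * (x * w) = z * (u 0 0 * w) ->
    x = u 0 0 / (b * c) * z.
  move=> nw E; apply: (mulfI nbc); apply: (mulIf nw); rewrite -mulrA E.
  by field; rewrite nb nc.
have r2' : r * r = -1 by rewrite -expr2.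
exists e, e'; split.
- apply: (solve _ _ _ vj); rewrite -/f j1 -b2.
  (* The factor r completes f to [r * c * f], which is h up to the sign e. *)
  apply: (mulfI nr); transitivity (b * (r * c * f)); first by ring.
  rewrite eE.
  transitivity (- (r * r) * ((-1) ^+ (e (+) e') * b * (b * g))); last by ring.
  by rewrite r2' opprK mul1r e'E signr_addb; case: e' {e'E}; ring.
- apply: (solve _ _ _ vi); rewrite l3 i1.
  transitivity (b * r * ((-1) ^+ e * h)); last by ring.
  rewrite -eE; transitivity ((r * r) * (b * c * f)); last by ring.
  by rewrite r2'; ring.
- apply: (solve _ _ _ vi); rewrite -/g i1.
  by transitivity (c * (b * g)); [ring | rewrite e'E; ring].
Qed.

End CyclicRelations.

Lemma ord4P (q : 'I_4) : [\/ q = 0, q = 1, q = 2 | q = 3].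
Proof.
by case: q => -[|[|[|[|]]]] // h;
  [constructor 1 | constructor 2 | constructor 3 | constructor 4]; apply/val_inj.
Qed.

Lemma sum_ord4 (V : nmodType) (F : 'I_4 -> V) :
  \sum_(q < 4) F q = F 0 + F 1 + F 2 + F 3.
Proof.
rewrite !big_ord_recl big_ord0 addr0 !addrA.
by congr (F _ + F _ + F _ + F _); apply/val_inj.
Qed.

(** * From relations in the free algebra and points of P^3 to equations on spanning vectors *)

Section Incidence.
Variable k : fieldType.
Implicit Types (f g : free4 k) (u v w : 'rV[k]_4) (p q : P3 k).

Lemma M1_mul_eq0 (al be ga : k) u v :
  M1 al be ga u *m v^T = 0 <-> cyc_rels al be ga 1 2 3 u v.
Proof.
split=> [/matrixP E | [[a1 a2] [b1 b2] [c1 c2]]].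
  split; split; apply/eqP; rewrite -subr_eq0; apply/eqP.
  (* Rows 0 to 2 carry the commutator relations and rows 3 to 5 the anticommutator ones, while
     [cyc_rels] pairs row n with row n + 3. *)
  - by have := E 0 0; rewrite !mxE sum_ord4 !mxE /= => <-; ring.
  - by have := E 3 0; rewrite !mxE sum_ord4 !mxE /= => <-; ring.
  - by have := E 1 0; rewrite !mxE sum_ord4 !mxE /= => <-; ring.
  - by have := E 4 0; rewrite !mxE sum_ord4 !mxE /= => <-; ring.
  - by have := E 2 0; rewrite !mxE sum_ord4 !mxE /= => <-; ring.
  - by have := E 5 0; rewrite !mxE sum_ord4 !mxE /= => <-; ring.
apply/matrixP => r s; rewrite ord1 !mxE sum_ord4 !mxE.
move/eqP: a1; rewrite -subr_eq0 => /eqP a1; move/eqP: a2; rewrite -subr_eq0 => /eqP a2.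
move/eqP: b1; rewrite -subr_eq0 => /eqP b1; move/eqP: b2; rewrite -subr_eq0 => /eqP b2.
move/eqP: c1; rewrite -subr_eq0 => /eqP c1; move/eqP: c2; rewrite -subr_eq0 => /eqP c2.
case: r => -[|[|[|[|[|[|]]]]]] //= _.
- by rewrite -a1; ring.
- by rewrite -b1; ring.
- by rewrite -c1; ring.
- by rewrite -a2; ring.
- by rewrite -b2; ring.
- by rewrite -c2; ring.
Qed.

Lemma biformB f g u v : biform (f - g) u v = biform f u v - biform g u v.
Proof.
rewrite /biform -sumrB; apply: eq_bigr => r _; rewrite -sumrB.
by apply: eq_bigr => s _; rewrite mcoeffB; ring.
Qed.

Lemma biformD f g u v : biform (f + g) u v = biform f u v + biform g u v.
Proof.
rewrite /biform -big_split; apply: eq_bigr => r _; rewrite -big_split.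
by apply: eq_bigr => s _ /=; rewrite mcoeffD; ring.
Qed.

Lemma biformZ t f u v : biform (t *: f) u v = t * biform f u v.
Proof.
rewrite /biform mulr_sumr; apply: eq_bigr => r _; rewrite mulr_sumr.
by apply: eq_bigr => s _ /=; rewrite mcoeffZ; ring.
Qed.

(** A product of two generators is a single word with coefficient 1, and words are equal exactly
    when their lists of letters are. *)
Lemma mcoeff_mul_y (r s r' s' : 'I_4) :
  (y k r * y k s)@_(fmmul (fmu r') (fmu s')) = ((r == r') && (s == s'))%:R.
Proof.
rewrite /y malgM_def fgmulUU mulr1 mcoeffU1; congr (_%:R).
rewrite -[X in X == _]/(fmmul (fmu r) (fmu s)) -val_eqE !fmmulE !fmuE /=.
by rewrite !eqseq_cons andbT.
Qed.

Lemma biform_mul (r s : 'I_4) u v : biform (y k r * y k s) u v = u 0 r * v 0 s.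
Proof.
rewrite /biform (bigD1 r) //= (bigD1 s) //= mcoeff_mul_y !eqxx mul1r.
rewrite !big1 ?addr0 // => [r' nr' | s' ns'].
  by apply: big1 => s' _; rewrite mcoeff_mul_y eq_sym (negbTE nr') !mul0r.
by rewrite mcoeff_mul_y [s == _]eq_sym (negbTE ns') andbF !mul0r.
Qed.

Lemma relations_cyc_rels (al be ga : k) u v :
  (forall f, f \in Qtilde_relations al be ga -> biform f u v = 0) <->
  cyc_rels al be ga 1 2 3 u v.
Proof.
have minusE t i j l : biform (rel_minus t i j l) u v =
    u 0 0 * v 0 i - u 0 i * v 0 0 - t * (u 0 j * v 0 l - u 0 l * v 0 j).
  rewrite /rel_minus biformB biformB biformZ biformB.
  (* rewrite biform_mul would unfold products of free4 and not terminate *)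
  by congr (_ - _ - _ * (_ - _)); apply: biform_mul.
have plusE i j l : biform (rel_plus k i j l) u v =
    u 0 0 * v 0 i + u 0 i * v 0 0 - (u 0 j * v 0 l + u 0 l * v 0 j).
  rewrite /rel_plus biformB; congr (_ - _); rewrite biformD.
    by congr (_ + _); apply: biform_mul.
  by congr (_ + _); apply: biform_mul.
split=> [E | [[a1 a2] [b1 b2] [c1 c2]] f].
  have R n (h : (n < size (Qtilde_relations al be ga))%N) := E _ (mem_nth 0 h).
  split; split; apply/eqP; rewrite -subr_eq0; apply/eqP.
  - exact: etrans (esym (minusE _ _ _ _)) (R 0%N isT).
  - exact: etrans (esym (plusE _ _ _)) (R 3%N isT).
  - exact: etrans (esym (minusE _ _ _ _)) (R 1%N isT).
  - exact: etrans (esym (plusE _ _ _)) (R 4%N isT).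
  - exact: etrans (esym (minusE _ _ _ _)) (R 2%N isT).
  - exact: etrans (esym (plusE _ _ _)) (R 5%N isT).
move=> /(nthP 0)[n n6 <-] {f}.
case: n n6 => [|[|[|[|[|[|n]]]]]] // _; apply: etrans.
- exact: minusE.
- by rewrite a1 subrr.
- exact: minusE.
- by rewrite b1 subrr.
- exact: minusE.
- by rewrite c1 subrr.
- exact: plusE.
- by rewrite a2 subrr.
- exact: plusE.
- by rewrite b2 subrr.
- exact: plusE.
- by rewrite c2 subrr.
Qed.

Lemma P3_vline p : exists2 u, u != 0 & line p = <[u]>%VS.
Proof.
case: p => L /= /eqP dL; have nL : vpick L != 0.
  by rewrite vpick0 -dimv_eq0 dL.
exists (vpick L) => //; apply/eqP; rewrite eq_sym eqEdim dim_vline nL dL leqnn.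
by rewrite -memvE memv_pick.
Qed.

Lemma vline_scale t w : t != 0 -> <[t *: w]>%VS = <[w]>%VS.
Proof.
move=> nt; apply/eqP; rewrite eqEsubv -!memvE memvZ ?memv_line //=.
by rewrite -{1}[w]scale1r -(mulVf nt) -scalerA memvZ ?memv_line.
Qed.

(** Bilinearity in (u, v) makes the relations a condition on a pair of lines, testable on any
    spanning vectors. *)
Lemma cyc_relsZ (al be ga : k) s t i j l u v :
  cyc_rels al be ga i j l u v -> cyc_rels al be ga i j l (s *: u) (t *: v).
Proof.
have cZ d i' j' l' : cyc_rel d i' j' l' u v -> cyc_rel d i' j' l' (s *: u) (t *: v).
  case=> [e e']; rewrite /cyc_rel !mxE; split.
    transitivity (s * t * (u 0 0 * v 0 i' - u 0 i' * v 0 0)); first by ring.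
    by rewrite e; ring.
  transitivity (s * t * (u 0 0 * v 0 i' + u 0 i' * v 0 0)); first by ring.
  by rewrite e'; ring.
by case=> *; split; apply: cZ.
Qed.

Lemma lines_cyc_rels (al be ga : k) p q u v :
  line p = <[u]>%VS -> line q = <[v]>%VS ->
  (forall u v, u \in line p -> v \in line q -> cyc_rels al be ga 1 2 3 u v) <->
  cyc_rels al be ga 1 2 3 u v.
Proof.
move=> -> ->; split=> [E | E _ _ /vlineP[s ->] /vlineP[t ->]].
  by apply: E; apply: memv_line.
exact: cyc_relsZ.
Qed.

Lemma M1_locusE (al be ga : k) p q u v :
  line p = <[u]>%VS -> line q = <[v]>%VS ->
  M1_locus al be ga (p, q) <-> cyc_rels al be ga 1 2 3 u v.
Proof.
move=> pu qv; rewrite -(lines_cyc_rels _ _ _ pu qv).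
by split=> E u' v' ? ?; apply/M1_mul_eq0/E.
Qed.

Lemma point_schemeE (al be ga : k) : point_scheme al be ga = M1_locus al be ga.
Proof.
apply/seteqP; split=> -[p q] E.
  move=> u v up vq; apply/M1_mul_eq0/relations_cyc_rels => f fR.
  exact: E.
by move=> f fR u v up vq; move: f fR; apply/relations_cyc_rels/M1_mul_eq0/E.
Qed.

Lemma mul_flip_mx (j q : 'I_4) u :
  (u *m flip_mx k j) 0 q = if (q == 0) || (q == j) then u 0 q else - u 0 q.
Proof.
by rewrite /flip_mx mul_mx_diag !mxE; case: ifP; rewrite ?mulr1 ?mulrN1.
Qed.

Lemma line_flip (j : 'I_4) p u :
  line p = <[u]>%VS -> line (flip j p) = <[u *m flip_mx k j]>%VS.
Proof. by move=> /= ->; rewrite limg_line lfunE. Qed.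

Lemma flipK (j : 'I_4) : involutive (@flip k j).
Proof.
move=> p; have [u _ pu] := P3_vline p; apply/val_inj.
apply: etrans (line_flip j (line_flip j pu)) _.
by rewrite -mulmxA flip_mxK mulmx1 -pu.
Qed.

Lemma has_coords_scale s p u w t :
  line p = <[u]>%VS -> u = t *: w -> u != 0 -> w \in s -> has_coords s p.
Proof.
move=> pu uw; rewrite uw scaler_eq0 negb_or => /andP[nt _] ws.
by apply/mapP; exists w; rewrite // pu uw vline_scale.
Qed.

Lemma has_coords_flip (j : 'I_4) s p :
  (forall w, w \in s -> w *m flip_mx k j \in s) ->
  has_coords s p -> has_coords s (flip j p).
Proof.
move=> st /mapP[w ws pw]; apply/mapP; exists (w *m flip_mx k j); first exact: st.
exact: line_flip.
Qed.

Lemma vec4P u (x0 x1 x2 x3 : k) :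
  u 0 0 = x0 -> u 0 1 = x1 -> u 0 2 = x2 -> u 0 3 = x3 -> u = vec4 x0 x1 x2 x3.
Proof.
move=> h0 h1 h2 h3; apply/rowP => q.
by case: (ord4P q) => ->; rewrite mxE.
Qed.

Lemma vec4_flip (x0 x1 x2 x3 : k) :
  ((vec4 x0 x1 x2 x3 *m flip_mx k 1 = vec4 x0 x1 (- x2) (- x3)) *
   (vec4 x0 x1 x2 x3 *m flip_mx k 2 = vec4 x0 (- x1) x2 (- x3)) *
   (vec4 x0 x1 x2 x3 *m flip_mx k 3 = vec4 x0 (- x1) (- x2) x3))%type.
Proof. by do !split; apply: vec4P; rewrite mul_flip_mx mxE. Qed.

End Incidence.

(** * The zeros of the relations, sorted by sign pattern *)

Section Classification.
Variable k : fieldType.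
Implicit Types (u v w : 'rV[k]_4) (p q : P3 k).

(** The three hypotheses together kill all twelve off-diagonal products u_m v_n. Nonzero coordinates
    of u and of v must therefore share their index, so both vectors are multiples of the same basis
    vector. *)
Lemma decoupled_PPinf p q u v : line p = <[u]>%VS -> line q = <[v]>%VS ->
  u != 0 -> v != 0 -> decoupled 1 2 3 u v -> decoupled 2 3 1 u v ->
  decoupled 3 1 2 u v -> PPinf p /\ q = p.
Proof.
move=> pu qv nu nv [a1 a2 a3 a4] [b1 b2 b3 b4] [c1 c2 c3 c4].
have uv m n : m != n -> u 0 m * v 0 n = 0.
  by case: (ord4P m) => ->; case: (ord4P n) => ->.
have [m um] := rV0Pn _ nu; have [n vn] := rV0Pn _ nv.
have mn : m = n.
  by apply/eqP; apply: contraT => /uv/eqP; rewrite mulf_eq0 (negbTE um) (negbTE vn).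
rewrite -{n}mn in vn.
have uE : u = u 0 m *: delta_mx 0 m.
  apply/rowP => s; rewrite !mxE /=; have [-> | ns] := eqVneq s m; first by rewrite mulr1.
  by move/uv/eqP: ns; rewrite mulf_eq0 (negbTE vn) orbF mulr0 => /eqP.
have vE : v = v 0 m *: delta_mx 0 m.
  apply/rowP => s; rewrite !mxE /=; have [-> | ns] := eqVneq s m; first by rewrite mulr1.
  by rewrite eq_sym in ns; move/uv/eqP: ns; rewrite mulf_eq0 (negbTE um) mulr0 => /eqP.
split; last by apply/val_inj; rewrite /= pu qv uE vE !vline_scale.
apply: (has_coords_scale pu uE nu); rewrite !inE.
case: (ord4P m) => ->; apply/or4P; [constructor 1 | constructor 2
  | constructor 3 | constructor 4]; by apply/eqP/vec4P; rewrite mxE.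
Qed.

Lemma line_flip_eq j p q u v t : line p = <[u]>%VS -> line q = <[v]>%VS ->
  v != 0 -> v = t *: (u *m flip_mx k j) -> q = flip j p.
Proof.
move=> pu qv nv vE; apply/val_inj; apply: etrans _ (esym (line_flip j pu)).
rewrite /= qv vE vline_scale //.
by apply: contraNneq nv => t0; rewrite vE t0 scale0r.
Qed.

Lemma cyc_sym_PP0 p q u v : line p = <[u]>%VS -> line q = <[v]>%VS ->
  cyc_sym 1 2 3 u v -> cyc_sym 2 3 1 u v -> cyc_sym 3 1 2 u v ->
  u 0 2 * v 0 3 != 0 -> PP0 p /\ q = p.
Proof.
move=> pu qv A1 A2 A3 n.
have [u0 v0 [v1 v2 v3] [e [e' [u1 u2 u3]]]] := cyc_sym_sym_sym A1 A2 A3 n.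
have nu : u != 0 by apply: contraNneq u0 => ->; rewrite mxE.
have nv : v != 0 by apply: contraNneq v0 => ->; rewrite mxE.
split.
  apply: (has_coords_scale pu (t := u 0 0)
    (w := vec4 1 ((-1) ^+ (e (+) e')) ((-1) ^+ e) ((-1) ^+ e'))) => //.
    apply/rowP => s; rewrite mxE.
    case: (ord4P s) => ->; rewrite mxE /= ?mulr1 //.
    - by rewrite u1 mulrC.
    - by rewrite u2 mulrC.
    - by rewrite u3 mulrC.
  (* The four choices of (e, e') are the four points of [PP0]. *)
  by rewrite !inE; case: e {u1 u2}; case: e' {u3}; rewrite ?expr0 ?expr1 eqxx ?orbT.
have vE : v = (v 0 0 / u 0 0) *: u.
  by apply/rowP => s; rewrite mxE; case: (ord4P s) => ->; rewrite // divfK.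
have t0 : v 0 0 / u 0 0 != 0 by rewrite mulf_neq0 ?invr_eq0.
by apply/val_inj; rewrite /= pu qv vE vline_scale.
Qed.

(** Keeping the indices general lets one statement serve [PP1], [PP2] and [PP3] by cyclic rotation.
    The vector w is u rescaled so that its coordinate 0 is b c, the normalisation used for the
    listed points. *)
Lemma cyc_sym_skew_flip (be ga b c r : k) i j l p q u v :
  be != 0 -> ga != 0 -> b ^+ 2 = be -> c ^+ 2 = ga -> r ^+ 2 = -1 ->
  uniq [:: 0; i; j; l] -> line p = <[u]>%VS -> line q = <[v]>%VS ->
  cyc_sym i j l u v -> cyc_skew be j l i u v -> cyc_skew ga l i j u v ->
  u 0 j * v 0 l != 0 ->
  q = flip i p /\ exists (e e' : bool) w, line p = <[w]>%VS /\
    [/\ w 0 0 = b * c, w 0 i = - ((-1) ^+ (e (+) e') * r),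
        w 0 j = (-1) ^+ e * (r * b) & w 0 l = (-1) ^+ e' * c].
Proof.
move=> be0 ga0 b2 c2 r2 un pu qv A1 A2 A3 n.
(* By counting, four distinct indices exhaust ['I_4]. *)
have mem s : s \in [:: 0; i; j; l].
  have sub : {subset [:: 0; i; j; l] <= enum 'I_4} by move=> x _; rewrite mem_enum.
  by have [|_ ->] := uniq_min_size un sub; rewrite ?mem_enum // -cardE card_ord.
have [u0 v0 [v1 v2 v3] [e [e' [u1 u2 u3]]]] :=
  cyc_sym_skew_skew be0 ga0 b2 c2 r2 A1 A2 A3 n.
have nv : v != 0 by apply: contraNneq v0 => ->; rewrite mxE.
have nbc : b * c != 0.
  by rewrite -[_ == _](expf_eq0 _ 2) exprMn b2 c2 mulf_neq0.
split.
  apply: (line_flip_eq (t := v 0 0 / u 0 0) pu qv nv).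
  apply/rowP => s; rewrite mxE mul_flip_mx; move: un (mem s); rewrite /= !inE !negb_or.
  case/and4P=> /and3P[i0 j0 l0] /andP[ij il] _ _ /or4P[] /eqP ->.
  - by rewrite divfK.
  - by rewrite eqxx orbT.
  - by rewrite eq_sym (negbTE j0) eq_sym (negbTE ij).
  - by rewrite eq_sym (negbTE l0) eq_sym (negbTE il).
exists e, e', ((b * c / u 0 0) *: u); split.
  by rewrite vline_scale // mulf_neq0 ?invr_eq0.
by rewrite !mxE u1 u2 u3 divfK //; split=> //; field; rewrite ?nbc ?u0;
  move: nbc; rewrite mulf_eq0 negb_or => /andP[-> ->].
Qed.

Section Locus.
Variables al be ga a b c r : k.
Hypotheses (n2 : (2 : k) != 0) (abg : al + be + ga + al * be * ga = 0).
Hypotheses (al_ok : al \notin [:: 0; 1; - 1]) (be_ok : be \notin [:: 0; 1; - 1])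
  (ga_ok : ga \notin [:: 0; 1; - 1]).
Hypotheses (a2 : a ^+ 2 = al) (b2 : b ^+ 2 = be) (c2 : c ^+ 2 = ga)
  (r2 : r ^+ 2 = - 1).

Lemma cyc_rels_PP p q u v : line p = <[u]>%VS -> line q = <[v]>%VS ->
  u != 0 -> v != 0 -> cyc_rels al be ga 1 2 3 u v ->
  PP a b c r p /\ q = theta a b c r p.
Proof.
move=> pu qv nu nv rels.
have parameter_neq (t : k) : t \notin [:: 0; 1; - 1] -> t != 0 /\ 1 + t != 0.
  by rewrite !inE !negb_or addrC addr_eq0 => /and3P[].
have [al0 al1] := parameter_neq _ al_ok.
have [be0 be1] := parameter_neq _ be_ok.
have [ga0 ga1] := parameter_neq _ ga_ok.
have abg2 : be + ga + al + be * ga * al = 0 by rewrite -[RHS]abg; ring.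
have abg3 : ga + al + be + ga * al * be = 0 by rewrite -[RHS]abg; ring.
have rels2 := cyc_rels_rot rels; have rels3 := cyc_rels_rot rels2.
have AS1 := cyc_sym_or_skew n2 (let: And3 h _ _ := rels in h)
  (cross2_eq0 n2 abg al1 be1 ga1 rels).
have AS2 := cyc_sym_or_skew n2 (let: And3 h _ _ := rels2 in h)
  (cross2_eq0 n2 abg2 be1 ga1 al1 rels2).
have AS3 := cyc_sym_or_skew n2 (let: And3 h _ _ := rels3 in h)
  (cross2_eq0 n2 abg3 ga1 al1 be1 rels3).
have [T0 T1 T2 T3] := thetaE al_ok be_ok ga_ok a2 b2 c2 r2 p.
(* Common exit of the degenerate cases: whatever the signs, these three products determine all the
   other off-diagonal ones. *)
have zero : u 0 2 * v 0 3 = 0 -> u 0 3 * v 0 1 = 0 -> u 0 1 * v 0 2 = 0 ->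
    PP a b c r p /\ q = theta a b c r p.
  move=> z1 z2 z3.
  have [pinf qp] := decoupled_PPinf pu qv nu nv (cyc_decoupled AS1 z1)
    (cyc_decoupled AS2 z2) (cyc_decoupled AS3 z3).
  by rewrite /PP /= pinf T0 ?pinf.
have sqr0 (x : k) : x ^+ 2 = 0 -> x = 0 by move/eqP; rewrite expf_eq0 => /eqP.
have mul0 (x z : k) : x != 0 -> 0 = x * z ^+ 2 -> z = 0.
  by move=> nx /esym/eqP; rewrite mulf_eq0 (negbTE nx) => /eqP/sqr0.
case: AS1 => A1; case: AS2 => A2; case: AS3 => A3.
- have [Q2 Q3] := cyc_sym_sym_sym_sqr A1 A2 A3.
  (* If this product vanishes, the relations between squares annihilate the other two. The same
     split recurs in the patterns with a single plus sign. *)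
  have [z | n] := eqVneq (u 0 2 * v 0 3) 0.
    by move: Q2 Q3; rewrite z expr0n => /sqr0 ? /sqr0 ?; apply: zero.
  have [p0 ->] := cyc_sym_PP0 pu qv A1 A2 A3 n.
  by rewrite /PP /= p0 orbT T0 ?p0 ?orbT.
- have [? ? ?] := cyc_skew_sym_sym n2 ga0 A3 A1 A2.
  exact: zero.
- have [? ? ?] := cyc_skew_sym_sym n2 be0 A2 A3 A1.
  exact: zero.
- have [Q3 Q2] := cyc_sym_skew_skew_sqr A1 A2 A3.
  have [z | n] := eqVneq (u 0 2 * v 0 3) 0.
    move: Q2 Q3; rewrite z expr0n -mulNr => /(mul0 _ _ be0) z2.
    by move=> /mul0 z3; apply: zero; rewrite // z3 // oppr_eq0.
  have [-> [e [e' [w [pw [w0 w1 w2 w3]]]]]] :=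
    cyc_sym_skew_flip (i := 1) (j := 2) (l := 3)
      be0 ga0 b2 c2 r2 isT pu qv A1 A2 A3 n.
  have p1 : PP1 b c r p.
    rewrite /PP1 /has_coords pw (vec4P w0 w1 w2 w3); apply: map_f; rewrite !inE.
    by case: e {w1 w2}; case: e' {w3};
      rewrite ?expr0 ?expr1 ?mulN1r ?mul1r ?opprK eqxx ?orbT.
  by rewrite /PP /= p1 !orbT T1.
- have [? ? ?] := cyc_skew_sym_sym n2 al0 A1 A2 A3.
  exact: zero.
- have [Q1 Q3] := cyc_sym_skew_skew_sqr A2 A3 A1.
  have [z | n] := eqVneq (u 0 3 * v 0 1) 0.
    move: Q3 Q1; rewrite z expr0n -mulNr => /(mul0 _ _ ga0) z3.
    by move=> /mul0 z1; apply: zero; rewrite // z1 // oppr_eq0.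
  have [-> [e [e' [w [pw [w0 w2 w3 w1]]]]]] :=
    cyc_sym_skew_flip (i := 2) (j := 3) (l := 1)
      ga0 al0 c2 a2 r2 isT pu qv A2 A3 A1 n.
  have p2 : PP2 a c r p.
    (* Rotation yields the coordinate c a, whereas [PP2] lists a c. *)
    rewrite mulrC in w0.
    rewrite /PP2 /has_coords pw (vec4P w0 w1 w2 w3); apply: map_f; rewrite !inE.
    by case: e {w2 w3}; case: e' {w1};
      rewrite ?expr0 ?expr1 ?mulN1r ?mul1r ?opprK eqxx ?orbT.
  by rewrite /PP /= p2 !orbT T2.
- have [Q2 Q1] := cyc_sym_skew_skew_sqr A3 A1 A2.
  have [z | n] := eqVneq (u 0 1 * v 0 2) 0.
    move: Q1 Q2; rewrite z expr0n -mulNr => /(mul0 _ _ al0) z1.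
    by move=> /mul0 z2; apply: zero; rewrite // z2 // oppr_eq0.
  have [-> [e [e' [w [pw [w0 w3 w1 w2]]]]]] :=
    cyc_sym_skew_flip (i := 3) (j := 1) (l := 2)
      al0 be0 a2 b2 r2 isT pu qv A3 A1 A2 n.
  have p3 : PP3 a b r p.
    rewrite /PP3 /has_coords pw (vec4P w0 w1 w2 w3); apply: map_f; rewrite !inE.
    by case: e {w3 w1}; case: e' {w2};
      rewrite ?expr0 ?expr1 ?mulN1r ?mul1r ?opprK eqxx ?orbT.
  by rewrite /PP /= p3 !orbT T3.
- apply: zero.
  + exact: cyc_skew_skew_skew n2 al0 A1 A2 A3.
  + exact: cyc_skew_skew_skew n2 be0 A2 A3 A1.
  + exact: cyc_skew_skew_skew n2 ga0 A3 A1 A2.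
Qed.

Lemma PP_cyc_rels p : PP a b c r p ->
  exists u v, [/\ line p = <[u]>%VS, line (theta a b c r p) = <[v]>%VS
    & cyc_rels al be ga 1 2 3 u v].
Proof.
have [T0 T1 T2 T3] := thetaE al_ok be_ok ga_ok a2 b2 c2 r2 p.
case/or4P => [pP | pP | pP | /orP[] pP].
- rewrite T0 ?pP //; have [w wP pw] := mapP pP; exists w, w; split=> //.
  by move: wP; rewrite !inE => /or4P[] /eqP ->; split; split; rewrite !mxE /=; ring.
- rewrite T0 ?pP ?orbT //; have [w wP pw] := mapP pP; exists w, w; split=> //.
  by move: wP; rewrite !inE => /or4P[] /eqP ->; split; split; rewrite !mxE /=; ring.
- rewrite T1 //; have [w wP pw] := mapP pP; exists w, (w *m flip_mx k 1).
  (* With the parameters written as squares, each relation at a listed point is a polynomial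
     identity modulo r^2 = -1. *)
  split; [by [] | exact: line_flip | rewrite -b2 -c2].
  by move: wP; rewrite !inE => /or4P[] /eqP ->; split; split;
    rewrite !mul_flip_mx !mxE /=; ring: r2.
- rewrite T2 //; have [w wP pw] := mapP pP; exists w, (w *m flip_mx k 2).
  split; [by [] | exact: line_flip | rewrite -a2 -c2].
  by move: wP; rewrite !inE => /or4P[] /eqP ->; split; split;
    rewrite !mul_flip_mx !mxE /=; ring: r2.
- rewrite T3 //; have [w wP pw] := mapP pP; exists w, (w *m flip_mx k 3).
  split; [by [] | exact: line_flip | rewrite -a2 -b2].
  by move: wP; rewrite !inE => /or4P[] /eqP ->; split; split;
    rewrite !mul_flip_mx !mxE /=; ring: r2.
Qed.

(** For each i, gamma_i permutes the four listed representatives of P_i. The image thus stays in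
    P_i, where [theta] applies the same involution again. *)
Lemma theta_PP p : PP a b c r p ->
  PP a b c r (theta a b c r p) /\ theta a b c r (theta a b c r p) = p.
Proof.
have T q := thetaE al_ok be_ok ga_ok a2 b2 c2 r2 q.
have [T0 T1 T2 T3] := T p.
move=> pPP; case/or4P: (pPP) => [pP | pP | pP | /orP[] pP].
- by rewrite !T0 ?pP.
- by rewrite !T0 ?pP ?orbT.
- have fP : PP1 b c r (flip 1 p).
    apply: (has_coords_flip _ pP) => w.
    rewrite !inE => /or4P[] /eqP ->;
      by rewrite vec4_flip ?opprK eqxx ?orbT.
  have [_ T1' _ _] := T (flip 1 p).
  by rewrite T1 // T1' // flipK /PP /= fP !orbT.
- have fP : PP2 a c r (flip 2 p).
    apply: (has_coords_flip _ pP) => w.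
    rewrite !inE => /or4P[] /eqP ->;
      by rewrite vec4_flip ?opprK eqxx ?orbT.
  have [_ _ T2' _] := T (flip 2 p).
  by rewrite T2 // T2' // flipK /PP /= fP !orbT.
- have fP : PP3 a b r (flip 3 p).
    apply: (has_coords_flip _ pP) => w.
    rewrite !inE => /or4P[] /eqP ->;
      by rewrite vec4_flip ?opprK eqxx ?orbT.
  have [_ _ _ T3'] := T (flip 3 p).
  by rewrite T3 // T3' // flipK /PP /= fP !orbT.
Qed.

End Locus.
End Classification.

Theorem theorem9p4 (k : closedFieldType) (alpha beta gamma a b c i : k)
    (char_k : 2%N \notin [pchar k])
    (abg : alpha + beta + gamma + alpha * beta * gamma = 0)
    (alpha_ok : alpha \notin [:: 0; 1; - 1])
    (beta_ok : beta \notin [:: 0; 1; - 1])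
    (gamma_ok : gamma \notin [:: 0; 1; - 1])
    (a2 : a ^+ 2 = alpha) (b2 : b ^+ 2 = beta) (c2 : c ^+ 2 = gamma)
    (i2 : i ^+ 2 = - 1) :
  [/\ point_scheme alpha beta gamma = M1_locus alpha beta gamma,
      M1_locus alpha beta gamma
        = [set (p, theta a b c i p) | p in PP a b c i]
    & set_bij (PP a b c i) (PP a b c i) (theta a b c i)].
Proof.
have n2 : (2 : k) != 0 by move: char_k; rewrite inE /=.
have tPP := theta_PP alpha_ok beta_ok gamma_ok a2 b2 c2 i2.
split; first exact: point_schemeE.
- apply/seteqP; split=> [[p q] | _ [p pPP <-]].
    have [u nu pu] := P3_vline p; have [v nv qv] := P3_vline q.
    move=> /(M1_locusE _ _ _ pu qv)/(cyc_rels_PP n2 abg alpha_ok beta_ok gamma_ok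
      a2 b2 c2 i2 pu qv nu nv)[pPP ->].
    by exists p.
  have [u [v [pu qv]]] := PP_cyc_rels alpha_ok beta_ok gamma_ok a2 b2 c2 i2 pPP.
  exact: (M1_locusE _ _ _ pu qv).2.
(* On [PP], [theta] is its own inverse, which gives both injectivity and surjectivity. *)
split=> [p /tPP[] // | p q /set_mem pP /set_mem qP pq | p pP].
  by have [_ <-] := tPP p pP; rewrite pq; have [_ ->] := tPP q qP.
by have [tP tK] := tPP p pP; exists (theta a b c i p).
Qed.
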